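(* Let $PR$ and $OPR$ be the Primal Routing and Optimized Primal Routing algorithms based on the same CDLP solution $x^*$, and assume the choice models satisfy the choice-model assumption stated in the context. Then the expected total reward of $OPR$ dominates that of $PR$: $$V^{OPR}(C,0)\ \ge\ V^{PR}(C,0).$$
   Context: **Model.** The horizon is $[0,1]$. There are $L$ resources, $N$ products and $K$ customer types. Resource $l$ has initial integer capacity $C_l$; $C=(C_1,\dots,C_L)$. Product $n\in\{1,\dots,N\}$ uses one unit of a single resource $l_n$ and earns reward $r_n$; $N_l=\{n:l_n=l\}$. Product $0$ is the no-purchase option, $r_0=0$. An assortment is a subset of $\{0,\dots,N\}$ containing $0$; $\mathcal S$ is the set of all assortments. Type-$k$ customers arrive according to independent non-homogeneous Poisson processes with known integrable rates $\lambda_k(t)\ge0$; $\Lambda_k=\int_0^1\lambda_k(s)ds$. A type-$k$ customer offered $S$ chooses exactly one $n\in S$, product $n$ with probability $P^k(n,S)$ ($\sum_{n\in S}P^k(n,S)=1$), independently of everything else given type and offered assortment. The state $(c,t)$ consists of the remaining inventory vector $c=(c_1,\dots,c_L)$, $c_l\in\{0,\dots,C_l\}$, and the time $t$; $e_l$ is the $l$-th unit vector. **Choice-model assumption.** For any assortment $S$, any real reward values $\rho_1,\dots,\rho_N$ (with $\rho_0=0$) and any type $k$, with $H=\{n\in S:\rho_n>0\}$: $\sum_{n\in H}\rho_nP^k(n,H\cup\{0\})\ge\sum_{n\in S}\rho_nP^k(n,S)$. **CDLP.** $x^*=(x_k^*(S))$ is a fixed ($\epsilon$-optimal) feasible solution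 of: maximize $\sum_k\sum_{S\in\mathcal S}\Lambda_kx_k(S)\sum_{n\in S}P^k(n,S)r_n$ subject to $\sum_k\Lambda_k\sum_{n\in N_j}\sum_{S\in\mathcal S:n\in S}x_k(S)P^k(n,S)\le C_j$ for all $j$; $\sum_{S\in\mathcal S}x_k(S)\le1$ for all $k$; $x_k(S)\ge0$. $A_k^{Static}$ is a random assortment with $P(A_k^{Static}=S)=x_k^*(S)$ (with any remaining probability it is $\{0\}$), drawn for each type-$k$ arrival independently of the time, inventory and all else. **Notation.** $\Delta_lV(c,t)=V(c,t)-V(c-e_l,t)$ if $c_l>0$ and $\infty$ if $c_l=0$. For a (possibly random) assortment $S$, $R_t^{kl}(S,z)=\lambda_k(t)\sum_{n\in N_l}\mathbf E[\mathbf 1(n\in S)P^k(n,S)](r_n-z)$ and $\mathcal R_t^{kl}(S,z)=\lambda_k(t)\sum_{n\in N_l}\mathbf E[\mathbf 1(n\in S)P^k(n,S)][r_n-z]^+$, with $[r_n-\infty]^+=0$ and $0\cdot\infty=0$. Differential equations are for functions absolutely continuous in $t$, for almost every $t$. **PR.** Offer each type-$k$ arrival the assortment $A_k^{Static}$ (which may contain out-of-stock products; choices are unaffected by inventory). If at state $(c,t)$ the customer chooses $n\ge1$ with $l=l_n$, the customer purchases it (earning $r_n$ and reducing $c_l$ by one) if and only if $c_l>0$ and $r_n\ge\Delta_lV^{PR}(c,t)$; otherwise the customer is rejected (no reward, no change in inventory). Here $V^{PR}(c,t)$ is the expected future reward of $PR$ from state $(c,t)$, determined by $$\frac{\partial V^{PR}(c,t)}{\partial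 t}=-\sum_{k=1}^K\sum_{l=1}^L\mathcal R_t^{kl}(A_k^{Static},\Delta_lV^{PR}(c,t)),\qquad V^{PR}(0,t)=0,\ V^{PR}(\cdot,1)=0.$$ **OPR.** Upon a type-$k$ arrival at state $(c,t)$, offer an assortment $A_k^{OPR}(c,t)$, containing no product whose resource has zero inventory, that aims at maximizing $\sum_{l}R_t^{kl}(S,\Delta_lV^{PR}(c,t))$ over $S\in\mathcal S$; it need not be an exact maximizer and may be any such assortment satisfying $$\sum_{l=1}^LR_t^{kl}(A_k^{OPR}(c,t),\Delta_lV^{PR}(c,t))\ \ge\ \sum_{l=1}^L\mathcal R_t^{kl}(A_k^{Static},\Delta_lV^{PR}(c,t)).$$ The customer purchases whichever product is chosen. The expected future reward $V^{OPR}(c,t)$ of $OPR$ satisfies $$\frac{\partial V^{OPR}(c,t)}{\partial t}=-\sum_{k=1}^K\sum_{l=1}^LR_t^{kl}(A_k^{OPR}(c,t),\Delta_lV^{OPR}(c,t)),\qquad V^{OPR}(0,t)=0,\ V^{OPR}(\cdot,1)=0.$$ *)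

(* Defs.v *)
From HB Require Import structures.
From mathcomp Require Import all_boot all_order all_algebra.
From mathcomp Require Import all_classical all_reals all_analysis.

Set Implicit Arguments.
Unset Strict Implicit.
Unset Printing Implicit Defensive.

Import Order.TTheory GRing.Theory Num.Theory.
Import numFieldNormedType.Exports.

Local Open Scope ring_scope.

(* The finite families of non-overlapping subintervals of [a, b] are
   ([u i, v i])_(i < n). *)
Definition abs_continuous (R : realType) (a b : R) (f : R -> R) : Prop :=
  forall eps : R, 0 < eps -> exists2 delta : R, 0 < delta &
    forall (n : nat) (u v : 'I_n -> R),
      (forall i, a <= u i /\ u i <= v i /\ v i <= b) ->
      (forall i j, i != j -> v i <= u j \/ v j <= u i) ->
      \sum_(i < n) (v i - u i) < delta ->
      \sum_(i < n) `|f (v i) - f (u i)| < eps.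

(* The options are encoded by [option 'I_N]: [None] is the no-purchase option
   (product 0) and [Some n], n : 'I_N, are the N products. *)
Definition is_assortment (N : nat) (S : {set option 'I_N}) : bool := None \in S.

Definition inventory (L : nat) := {ffun 'I_L -> nat}.

(* [choice_prob k n S] is P^k(n, S); its value is meaningful only when S is an
   assortment and n is in S. *)
Record model (R : realType) (L N K : nat) := Model {
  cap : inventory L;
  res : 'I_N -> 'I_L;
  reward : 'I_N -> R;
  rate : 'I_K -> R -> R;
  choice_prob : 'I_K -> option 'I_N -> {set option 'I_N} -> R;
  rate_ge0 : forall k t, 0 <= t <= 1 -> 0 <= rate k t;
  rate_integrable : forall k,
    (@lebesgue_measure R).-integrable `[0, 1]%classic (EFin \o rate k);
  choice_ge0 : forall k n S, is_assortment S -> n \in S -> 0 <= choice_prob k n S;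
  choice_sum1 : forall k S, is_assortment S -> \sum_(n in S) choice_prob k n S = 1
}.

Section Model.
Context {R : realType} {L N K : nat}.
Variable m : model R L N K.

Local Notation assort := {set option 'I_N}.

(* [oapp rho 0] extends rho by the value 0 at the no-purchase option. *)
Definition choice_assumption : Prop :=
  forall (S : assort) (rho : 'I_N -> R) (k : 'I_K), is_assortment S ->
    let H := [set n in S | 0 < oapp rho 0 n] in
    \sum_(n in H) oapp rho 0 n * choice_prob m k n (None |: H) >=
    \sum_(n in S) oapp rho 0 n * choice_prob m k n S.

Definition Lambda (k : 'I_K) : R :=
  Rintegral (@lebesgue_measure R) `[0, 1]%classic (rate m k).

Definition cdlp_objective (x : 'I_K -> assort -> R) : R :=
  \sum_(k < K) \sum_(S : assort | is_assortment S)
    Lambda k * x k S *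
    \sum_(n in S) choice_prob m k n S * oapp (reward m) 0 n.

Definition cdlp_feasible (x : 'I_K -> assort -> R) : Prop :=
  [/\ forall j : 'I_L,
        \sum_(k < K) Lambda k *
          \sum_(n < N | res m n == j)
            \sum_(S : assort | is_assortment S && (Some n \in S))
              x k S * choice_prob m k (Some n) S
        <= (cap m j)%:R,
      forall k, \sum_(S : assort | is_assortment S) x k S <= 1 &
      forall k (S : assort), is_assortment S -> 0 <= x k S].

Definition cdlp_eps_optimal (eps : R) (x : 'I_K -> assort -> R) : Prop :=
  cdlp_feasible x /\
  forall y, cdlp_feasible y -> cdlp_objective y - eps <= cdlp_objective x.

(* Random assortments are represented by their probability mass functions. *)
Definition static_assortment (x : 'I_K -> assort -> R) (k : 'I_K) : assort -> R :=
  fun S => x k S +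
    (S == [set None])%:R * (1 - \sum_(S' : assort | is_assortment S') x k S').

Definition fixed_assortment (S : assort) : assort -> R := fun S' => (S' == S)%:R.

(* E[1(n \in S) P^k(n, S)] for S distributed according to q. *)
Definition mean_choice (k : 'I_K) (n : 'I_N) (q : assort -> R) : R :=
  \sum_(S : assort | is_assortment S)
    q S * ((Some n \in S)%:R * choice_prob m k (Some n) S).

Definition Delta (V : inventory L -> R -> R) (l : 'I_L) (c : inventory L) (t : R)
    : \bar R :=
  if (0 < c l)%N then
    (V c t - V [ffun j => (c j - (j == l))%N] t)%:E
  else +oo%E.

Local Open Scope ereal_scope.

(* The two functionals R_t^{kl}(S, z) and calligraphic R_t^{kl}(S, z). The
   conventions 0 * oo = 0 and [r - oo]^+ = 0 are those of \bar R. *)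
Definition Rrate (t : R) (k : 'I_K) (l : 'I_L) (q : assort -> R) (z : \bar R)
    : \bar R :=
  (rate m k t)%:E *
  \sum_(n < N | res m n == l) (mean_choice k n q)%:E * ((reward m n)%:E - z).

Definition Rrate_plus (t : R) (k : 'I_K) (l : 'I_L) (q : assort -> R) (z : \bar R)
    : \bar R :=
  (rate m k t)%:E *
  \sum_(n < N | res m n == l)
    (mean_choice k n q)%:E * maxe ((reward m n)%:E - z) 0.

Definition in_range (c : inventory L) : Prop := forall l, (c l <= cap m l)%N.

(* V is an absolutely continuous solution on [0, 1] of dV(c, t)/dt = - F c t
   for almost every t, with the boundary conditions of a value function. *)
Definition solves_value_equation
    (F : inventory L -> R -> \bar R) (V : inventory L -> R -> R) : Prop :=
  [/\ forall c, in_range c -> abs_continuous 0%R 1%R (V c),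
      forall c, in_range c ->
        {ae (@lebesgue_measure R), forall t : R, (0 <= t <= 1)%R ->
           derivable (V c) t 1 /\ (derive1 (V c) t)%:E = - F c t},
      forall t : R, (0 <= t <= 1)%R -> V [ffun=> 0%N] t = 0%R &
      forall c, in_range c -> V c 1%R = 0%R].

Definition is_PR_value (x : 'I_K -> assort -> R) (V : inventory L -> R -> R)
    : Prop :=
  solves_value_equation
    (fun c t => \sum_(k < K) \sum_(l < L)
       Rrate_plus t k l (static_assortment x k) (Delta V l c t)) V.

Definition is_OPR_policy (x : 'I_K -> assort -> R) (VPR : inventory L -> R -> R)
    (A : 'I_K -> inventory L -> R -> assort) : Prop :=
  forall k c (t : R), in_range c -> (0 <= t <= 1)%R ->
    [/\ is_assortment (A k c t),
        forall n, Some n \in A k c t -> (0 < c (res m n))%N &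
        \sum_(l < L) Rrate t k l (fixed_assortment (A k c t)) (Delta VPR l c t) >=
        \sum_(l < L) Rrate_plus t k l (static_assortment x k) (Delta VPR l c t)].

Definition is_OPR_value (A : 'I_K -> inventory L -> R -> assort)
    (V : inventory L -> R -> R) : Prop :=
  solves_value_equation
    (fun c t => \sum_(k < K) \sum_(l < L)
       Rrate t k l (fixed_assortment (A k c t)) (Delta V l c t)) V.

End Model.

(* Main.v *)
(* Let W = V^OPR - V^PR. The defining inequality of OPR turns the two value
   equations into W'(c, t) <= sum_l g_l(t) (W(c, t) - W(c - e_l, t)) for almost
   every t, with rates g_l >= 0 that vanish when c_l = 0. By induction on the
   total inventory W(c - e_l, .) >= 0, so W(c, .) is nonincreasing wherever it is
   nonpositive; as W(c, 1) = 0, it can never be negative. That an absolutely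
   continuous function with nonpositive derivative almost everywhere is
   nonincreasing is proved with a fine partition of the interval: a piece tagged
   at a good point contributes little by differentiability, and the pieces tagged
   in the exceptional null set lie in an open set of small measure. *)
Require Import Defs.
From mathcomp Require Import all_boot all_order all_algebra.
From mathcomp Require Import all_classical all_reals all_analysis.
From mathcomp Require Import measurable_realfun lra.

Set Implicit Arguments.
Unset Strict Implicit.
Unset Printing Implicit Defensive.

Import Order.TTheory GRing.Theory Num.Theory.
Import numFieldNormedType.Exports.
Local Open Scope classical_set_scope.
Local Open Scope ring_scope.

(** * Monotonicity and sign of absolutely continuous functions *)

#[local] Instance lebesgue_ae_filter (R : realType) :
  Filter (nbhs (almost_everywhere (@lebesgue_measure R))).
Proof. exact: ae_filter_ringOfSetsType. Qed.

(* A form of Cousin's lemma. *)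
Lemma interval_induction (R : realType) (a b : R) (P : R -> R -> Prop) :
  a <= b ->
  (forall u v w, a <= u -> u <= v -> v <= w -> w <= b ->
     P u v -> P v w -> P u w) ->
  (forall t, a <= t <= b -> exists2 d : R, 0 < d &
     forall u v, a <= u -> u <= t -> t <= v -> v <= b ->
       t - u < d -> v - t < d -> P u v) ->
  P a b.
Proof.
move=> ab Padd Ploc.
pose S := [set s | a <= s <= b /\ P a s].
have Sa : S a.
  split; first by rewrite lexx.
  have [|d d0 Pd] := Ploc a; first by rewrite lexx.
  by apply: Pd => //; rewrite subrr.
have ubS : has_ubound S by exists b => s [/andP[]].
have supS : has_sup S by split; [exists a|].
have at_ : a <= sup S by exact: ub_le_sup.
have tb : sup S <= b by apply: ge_sup; [exists a|move=> s [/andP[]]].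
have [|d d0 Pd] := Ploc (sup S); first by rewrite at_.
have [s [/andP[as_ sb] Pas] ts] := sup_adherent d0 supS.
have st : s <= sup S by apply: ub_le_sup => //; split=> //; rewrite as_.
(* The local property at [sup S] extends [P a s] to [P a v], past [sup S] unless [v = b]. Since [v]
   is in [S], only [v = b] remains. *)
pose v := Num.min b (sup S + d / 2).
have tv : sup S <= v by rewrite le_min tb; lra.
have vb : v <= b by rewrite ge_min lexx.
have vtd : v <= sup S + d / 2 by rewrite ge_min lexx orbT.
have Pav : P a v by apply: (Padd a s v) => //; [lra|apply: Pd => //; lra].
have vt : v <= sup S by apply: ub_le_sup => //; split => //; rewrite vb andbT; lra.
suff -> : b = v by [].
apply/eqP; rewrite eq_le vb andbT.
by move: vt; rewrite {1}/v ge_min => /orP[bt|]; lra.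
Qed.

(** Lists, unlike indexed families, concatenate directly when partitions of adjacent intervals are
    glued. *)
Lemma abs_continuous_seq (R : realType) (a b : R) (f : R -> R) :
  abs_continuous a b f -> forall eps, 0 < eps -> exists2 delta : R, 0 < delta &
    forall s : seq (R * R),
      all (fun p => [&& a <= p.1, p.1 <= p.2 & p.2 <= b]) s ->
      pairwise (fun p q => p.2 <= q.1) s ->
      \sum_(p <- s) (p.2 - p.1) < delta ->
      \sum_(p <- s) `|f p.2 - f p.1| < eps.
Proof.
move=> fac eps /fac[delta d0 fd]; exists delta => // s alls pws.
rewrite !(big_nth (0, 0)) !big_mkord => sd.
apply: (fd _ (fun i : 'I_(size s) => (nth (0, 0) s i).1)
             (fun i => (nth (0, 0) s i).2)) => //.
  by move=> i; have /and3P[] := all_nthP (0, 0) alls i (ltn_ord i).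
move=> i j; rewrite neq_ltn => /orP[] ij; [left|right];
  by apply: (pairwiseP (0, 0) pws) => //; rewrite inE.
Qed.

Lemma abs_continuous_itv (R : realType) (a b c d : R) (f : R -> R) :
  a <= c -> d <= b -> abs_continuous a b f -> abs_continuous c d f.
Proof.
move=> ac db fac eps /fac[delta d0 fd]; exists delta => // n u v uv.
by apply: fd => i; have [? [? ?]] := uv i; do !split => //; lra.
Qed.

Lemma abs_continuousB (R : realType) (a b : R) (f g : R -> R) :
  abs_continuous a b f -> abs_continuous a b g -> abs_continuous a b (f - g).
Proof.
move=> fac gac eps e0; have e20 : 0 < eps / 2 by lra.
have [d1 d10 fd] := fac _ e20; have [d2 d20 gd] := gac _ e20.
exists (Num.min d1 d2); first by rewrite lt_min d10.
move=> n u v uv uvd; rewrite lt_min => /andP[s1 s2].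
have lf := fd n u v uv uvd s1; have lg := gd n u v uv uvd s2.
apply: (@le_lt_trans _ _ (\sum_(i < n) `|f (v i) - f (u i)| +
                          \sum_(i < n) `|g (v i) - g (u i)|)); last by lra.
rewrite -big_split /=; apply: ler_sum => i _.
rewrite !fctE (_ : _ - _ = (f (v i) - f (u i)) - (g (v i) - g (u i))); last by lra.
exact: ler_normB.
Qed.

(** The Caratheodory slope [g] of [f] at [t] is continuous there with [g t <= 0], so [g <= eps]
    nearby. The increments over [[u, t]] and [[t, v]] add up. *)
Lemma derive_le0_increment (R : realType) (f : R -> R) (t eps : R) :
  derivable f t 1 -> f^`()%classic t <= 0 -> 0 < eps ->
  exists2 d : R, 0 < d & forall u v, u <= t -> t <= v ->
    t - u < d -> v - t < d -> f v - f u <= eps * (v - u).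
Proof.
move=> ft f't e0.
have /is_derive1_caratheodory[g [fg gt gE]] : is_derive t 1 f (f^`()%classic t).
  by rewrite derive1E; exact: derivableP.
have /cvgrPdist_lt/(_ _ e0)/nbhs_ballP[d /= d0 gd] := gt.
have {}gd z : `|t - z| < d -> g z <= eps.
  by move=> /gd /=; rewrite gE ltr_norml => /andP[]; lra.
exists d => // u v ut tv tu vt.
have gu : g u <= eps by apply: gd; rewrite ger0_norm; lra.
have gv : g v <= eps by apply: gd; rewrite ler0_norm; lra.
have := fg u; have := fg v; nra.
Qed.

Lemma abs_continuous_nonincreasing (R : realType) (a b : R) (f : R -> R) :
  a <= b -> abs_continuous a b f ->
  {ae (@lebesgue_measure R), forall t, a <= t <= b ->
     derivable f t 1 /\ f^`()%classic t <= 0} ->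
  f b <= f a.
Proof.
move=> ab fac [E [mE E0' EP]].
pose mu := @lebesgue_measure R.
have E0 : mu E = 0%E by exact: E0'.
apply/ler_addgt0Pr => eps e0.
(* The good pieces then cost at most [eps / 2] in total; the extra 1 keeps the divisor positive when
   [a = b]. *)
pose e1 := eps / 2 / (1 + b - a).
have e10 : 0 < e1 by rewrite !divr_gt0//; lra.
have e20 : 0 < eps / 2 by lra.
have [delta d0 fd] := abs_continuous_seq fac e20.
have [|U [oU EU muU]] := lebesgue_regularity_outer mE _ d0.
  by apply: (@le_lt_trans _ _ 0%E); [rewrite -E0|exact: ltry].
have mU : measurable U by exact: open_measurable.
have {}muU : (mu U < delta%:E)%E.
  have -> : mu U = (mu (U `\` E) + mu (U `&` E))%E by exact: measureDI.
  by rewrite (setIidr EU) E0 adde0.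
(* [s] lists the pieces tagged in the exceptional set. *)
pose P u v := exists s : seq (R * R),
  [/\ all (fun p => [&& u <= p.1, p.1 <= p.2 & p.2 <= v]) s,
      pairwise (fun p q => p.2 <= q.1) s,
      ((\sum_(p <- s) (p.2 - p.1))%:E <= mu (U `&` `[u, v[))%E &
      f v - f u <= e1 * (v - u) + \sum_(p <- s) `|f p.2 - f p.1|].
suff [s [alls pws mus fs]] : P a b.
  have : \sum_(p <- s) `|f p.2 - f p.1| < eps / 2.
    apply: fd => //; rewrite -lte_fin; apply: le_lt_trans mus _.
    apply: le_lt_trans muU; apply: le_measure; rewrite ?inE//.
    by apply: measurableI.
  have : e1 * (b - a) <= eps / 2.
    rewrite /e1 mulrAC ler_pdivrMr; last by lra.
    by rewrite ler_pM2l; lra.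
  lra.
apply: interval_induction => // [u v w au uv vw wb|t tab].
  move=> [s [alls pws mus fs]] [r [allr pwr mur fr]]; exists (s ++ r); split.
  - rewrite all_cat; apply/andP; split.
      by apply: sub_all alls => p /and3P[-> -> pv] /=; exact: le_trans vw.
    by apply: sub_all allr => p /and3P[vp -> ->] /=; rewrite (le_trans uv).
  - rewrite pairwise_cat pws pwr !andbT.
    apply/allrelP => p q /(allP alls)/and3P[_ _ pv] /(allP allr)/and3P[vq _ _].
    exact: le_trans vq.
  - rewrite big_cat/= EFinD.
    have mUI (x y : R) : measurable (U `&` `[x, y[) by exact: measurableI.
    (* Half-open intervals make the two traces on [U] disjoint with exact union, so the length
       bounds add. *)
    have <- : (U `&` `[u, v[) `|` (U `&` `[v, w[) = U `&` `[u, w[.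
      rewrite -setIUr; congr (_ `&` _).
      apply/seteqP; split => [z /= [] | z /=]; rewrite !in_itv/= => /andP[uz zw].
      - by rewrite uz (lt_le_trans zw).
      - by rewrite zw andbT (le_trans uv).
      - by have [zv|vz] := ltP z v; [left; rewrite uz|right].
    have -> : mu ((U `&` `[u, v[) `|` (U `&` `[v, w[)) =
              (mu (U `&` `[u, v[) + mu (U `&` `[v, w[))%E.
      apply: measureU; [exact: mUI|exact: mUI|]; apply/seteqP; split => // z /= [[_ +] [_ +]].
      by rewrite !in_itv/= => /andP[_ zv] /andP[]; rewrite leNgt zv.
    exact: leeD.
  - by rewrite big_cat/=; lra.
(* At a tag in [E], the piece lies in [U] and is listed whole; at any other tag the list is empty
   and the derivative estimate suffices. *)
have [Et|nEt] := pselect (E t).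
  have /nbhs_ballP[d /= d0' Ud] : nbhs t U.
    by apply: open_nbhs_nbhs; split => //; exact: EU.
  exists d => // u v au ut tv vb tu vt.
  exists [:: (u, v)]; split; rewrite ?big_seq1 /= ?lexx ?(le_trans ut)//.
    rewrite setIidr => [|z /=].
      rewrite /mu lebesgue_measure_itv/= lte_fin; case: ltP => //.
      by rewrite lee_fin; lra.
    rewrite in_itv/= => /andP[uz zv].
    by apply: Ud; rewrite /ball/= ltr_norml; lra.
  have : 0 <= e1 * (v - u) by rewrite mulr_ge0//; lra.
  have := ler_norm (f v - f u); lra.
have [ft f't] : derivable f t 1 /\ f^`()%classic t <= 0.
  by apply: contrapT => h; apply: nEt; apply: EP => /(_ tab).
have [d d0' fdt] := derive_le0_increment ft f't e10.
exists d => // u v au ut tv vb tu vt; exists [::]; split => //.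
  by rewrite big_nil.
by rewrite big_nil addr0; exact: fdt.
Qed.

(** If [f t < 0], then [f] is negative, hence nonincreasing, from [t] until [inf Z]. It would have
    to jump from at most [f t] to a nonnegative value there, against continuity. *)
Lemma abs_continuous_ge0 (R : realType) (a b : R) (f : R -> R) :
  abs_continuous a b f -> 0 <= f b ->
  {ae (@lebesgue_measure R), forall t, a <= t <= b ->
     derivable f t 1 /\ (f t <= 0 -> f^`()%classic t <= 0)} ->
  forall t, a <= t <= b -> 0 <= f t.
Proof.
move=> fac fb0 f'le t /andP[at_ tb]; rewrite leNgt; apply/negP => ft0.
pose Z := [set s | t <= s <= b /\ 0 <= f s].
have Zb : Z b by split => //; rewrite tb lexx.
have lbZ : has_lbound Z by exists t => s [/andP[]].
have tz : t <= inf Z by apply: lb_le_inf; [exists b|move=> s [/andP[]]].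
have le_ft s : t <= s -> s = t \/ s < inf Z -> f s <= f t.
  move=> ts [->//|sZ].
  have sb : s <= b by rewrite ltW// (lt_le_trans sZ)// ge_inf.
  apply: abs_continuous_nonincreasing => //; first exact: abs_continuous_itv fac.
  apply: filterS f'le => r fr /andP[tr rs].
  have [|? fr0] := fr; first by lra.
  split=> //; apply: fr0; rewrite leNgt; apply/negP => fr0.
  suff : inf Z <= r by lra.
  by apply: ge_inf => //; split; lra.
have nft0 : 0 < - f t by lra.
have [d d0 fd] := abs_continuous_seq fac nft0.
have d20 : 0 < d / 2 by lra.
have [|r [/andP[tr rb] fr0] rZ] := inf_adherent d20 (E := Z).
  by split=> //; exists b.
have Zr : inf Z <= r by apply: ge_inf => //; split => //; rewrite tr.
(* The point [s] is just before [inf Z], or [t] itself when [t] is already that close; [f] then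
   rises by at least [- f t] over a length below [d]. *)
have [s [ts sr rs fs]] : exists s, [/\ t <= s, s <= r, r - s < d & f s <= f t].
  have [tZ|Zt] := ltP (t + d / 4) (inf Z).
    by exists (inf Z - d / 4); split; [lra..|apply: le_ft; [lra|right; lra]].
  by exists t; split; lra.
have := fd [:: (s, r)]; rewrite !big_seq1 /= => /(_ _ isT rs) fsr.
have := ler_norm (f r - f s).
have : `|f r - f s| < - f t by apply: fsr; lra.
lra.
Qed.

(** * Comparison of the two value equations *)

Section Drift.
Context {R : realType} {L N K : nat}.
Variable m : model R L N K.
Implicit Types (S : {set option 'I_N}) (c : inventory L) (t : R).

(** Truncated subtraction fixes [c] when resource [l] is out of stock, so value differences stay
    finite there, unlike [Delta]. *)
Definition sell (c : inventory L) (l : 'I_L) : inventory L :=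
  [ffun j => (c j - (j == l))%N].

Lemma sell_out c l : c l = 0%N -> sell c l = c.
Proof.
move=> cl0; apply/ffunP => j; rewrite ffunE.
by case: eqP => [->|_]; rewrite ?cl0 // subn0.
Qed.

Lemma in_range_sell c l : in_range m c -> in_range m (sell c l).
Proof. by move=> cm j; rewrite ffunE (leq_trans (leq_subr _ _)). Qed.

Lemma sum_sell_lt c l : (0 < c l)%N ->
  (\sum_j sell c l j < \sum_j c j)%N.
Proof.
move=> cl0; rewrite (bigD1 l)//= [ltnRHS](bigD1 l)//= -addSn leq_add//.
  by rewrite ffunE eqxx subn1 prednK.
by apply: leq_sum => j _; rewrite ffunE leq_subr.
Qed.

Lemma mean_choice_fixed_ge0 k n S : 0 <= mean_choice m k n (fixed_assortment S).
Proof.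
apply: sumr_ge0 => T aT; rewrite mulr_ge0 ?ler0n//.
by have [nT|_] := boolP (Some n \in T); rewrite ?mul0r ?mul1r ?choice_ge0.
Qed.

Lemma mean_choice_fixed_notin k n S :
  Some n \notin S -> mean_choice m k n (fixed_assortment S) = 0.
Proof.
move=> nS; apply: big1 => T _; rewrite /fixed_assortment.
by have [->|_] := eqVneq T S; rewrite ?mul0r// (negbTE nS) mul0r mulr0.
Qed.

Definition drift (A : 'I_K -> {set option 'I_N}) (V : inventory L -> R -> R) c t
    : R :=
  \sum_(k < K) \sum_(l < L) rate m k t *
    \sum_(n < N | res m n == l)
      mean_choice m k n (fixed_assortment (A k)) *
      (reward m n - (V c t - V (sell c l) t)).

(* The infinite values of [Delta] are all multiplied by zero probabilities. *)
Lemma sum_Rrate_fixed (A : 'I_K -> {set option 'I_N}) V c t :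
  (forall k n, Some n \in A k -> (0 < c (res m n))%N) ->
  (\sum_(k < K) \sum_(l < L)
     Rrate m t k l (fixed_assortment (A k)) (Delta V l c t))%E
  = (drift A V c t)%:E.
Proof.
move=> Ac; rewrite -sumEFin; apply: eq_bigr => k _.
rewrite -sumEFin; apply: eq_bigr => l _.
rewrite /Rrate EFinM; congr (_ * _)%E.
rewrite -sumEFin; apply: eq_bigr => n /eqP nl; rewrite EFinM.
have [nA|nA] := boolP (Some n \in A k).
  by rewrite /Delta -nl (Ac k).
by rewrite mean_choice_fixed_notin// !mul0e.
Qed.

(** A smaller marginal value of inventory raises every net reward, and the weights are nonnegative.
    Out-of-stock resources have marginal value 0 on both sides. *)
Lemma drift_le (A : 'I_K -> {set option 'I_N}) (V W : inventory L -> R -> R) c t :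
  0 <= t <= 1 ->
  (forall l, (0 < c l)%N ->
     W c t - W (sell c l) t <= V c t - V (sell c l) t) ->
  drift A V c t <= drift A W c t.
Proof.
move=> t01 VW; apply: ler_sum => k _; apply: ler_sum => l _.
apply: ler_wpM2l; first exact: rate_ge0.
apply: ler_sum => n _; apply: ler_wpM2l; first exact: mean_choice_fixed_ge0.
rewrite lerB//.
have [/sell_out->|/VW//] := posnP (c l).
by rewrite !subrr.
Qed.

Lemma PR_le_OPR (x : 'I_K -> {set option 'I_N} -> R)
    (VPR VOPR : inventory L -> R -> R)
    (A : 'I_K -> inventory L -> R -> {set option 'I_N}) :
  is_PR_value m x VPR -> is_OPR_policy m x VPR A -> is_OPR_value m A VOPR ->
  forall c, in_range m c -> forall t, 0 <= t <= 1 -> VPR c t <= VOPR c t.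
Proof.
move=> [acP deP _ bP] pol [acO deO _ bO] c.
(* Zero inventory needs no separate case: [IH] is applied only to resources with positive stock. *)
have [s] := ubnP (\sum_j c j)%N; elim: s c => // s IH c cs cm t t01.
rewrite -subr_ge0.
apply: (@abs_continuous_ge0 _ 0 1 (VOPR c - VPR c)) => // {t t01}.
- by apply: abs_continuousB; [exact: acO|exact: acP].
- by rewrite !fctE bO// bP// subrr.
apply: filterS2 (deP c cm) (deO c cm) => t eP eO t01.
have [dP {}eP] := eP t01; have [dO {}eO] := eO t01.
split; first exact: derivableB.
rewrite !fctE derive1E deriveB// -!derive1E => W0.
have Ac k n : Some n \in A k c t -> (0 < c (res m n))%N.
  by have [_ + _] := pol k c t cm t01; exact.
move: eO; rewrite sum_Rrate_fixed// -EFinN => -[->].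
(* The defining inequality of the policy, summed over customer types, replaces the routing rates of
   PR by the drift of OPR's assortments evaluated at [VPR]. *)
have : ((- drift (fun k => A k c t) VPR c t)%:E <= ((VPR c)^`()%classic t)%:E)%E.
  rewrite eP EFinN leeN2 -sum_Rrate_fixed//; apply: lee_sum => k _.
  by have [] := pol k c t cm t01.
rewrite lee_fin => lbP.
suff : drift (fun k => A k c t) VPR c t <= drift (fun k => A k c t) VOPR c t.
  by lra.
(* Here [VOPR <= VPR] at [c] by [W0] and [VPR <= VOPR] at [sell c l] by [IH], so marginal values
   under [VOPR] are the smaller ones. *)
apply: drift_le => // l cl.
have := IH (sell c l) (leq_trans (sum_sell_lt cl) cs) (in_range_sell l cm) t t01.
by lra.
Qed.

End Drift.

Theorem theorem8 (R : realType) (L N K : nat) (m : model R L N K)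
    (eps : R) (x : 'I_K -> {set option 'I_N} -> R)
    (VPR VOPR : inventory L -> R -> R)
    (A : 'I_K -> inventory L -> R -> {set option 'I_N}) :
  choice_assumption m ->
  0 <= eps ->
  cdlp_eps_optimal m eps x ->
  is_PR_value m x VPR ->
  is_OPR_policy m x VPR A ->
  is_OPR_value m A VOPR ->
  VPR (cap m) 0 <= VOPR (cap m) 0.
Proof.
move=> _ _ _ PR pol OPR; apply: (PR_le_OPR PR pol OPR) => [l //|].
by rewrite lexx ler01.
Qed.
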